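(* For every integer $k\ge 1$, the cycle $C_{4k}$ admits a $2$-graceful $\alpha$-labeling.
   Context: $C_n$ denotes the cycle on $n$ vertices (with $n$ edges). For a graph $\Gamma$ of size $e$ and a divisor $d$ of $e$ with $e=d\cdot m$, a $d$-graceful labeling of $\Gamma$ is an injective function $f:V(\Gamma)\to\{0,1,\ldots,d(m+1)-1\}$ such that $\{|f(x)-f(y)| : [x,y]\in E(\Gamma)\}=\{1,2,\ldots,d(m+1)-1\}\setminus\{m+1,2(m+1),\ldots,(d-1)(m+1)\}$. If $\Gamma$ is bipartite with parts $X,Y$, a $d$-graceful $\alpha$-labeling is a $d$-graceful labeling $f$ such that $\max f(X)<\min f(Y)$ for a suitable ordering of the two parts. *)

(* Defs.v *)
From HB Require Import structures.
From mathcomp Require Import all_boot all_order all_algebra.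
Export ssrint.IntDist.

Set Implicit Arguments.
Unset Strict Implicit.
Unset Printing Implicit Defensive.

Record sgraph := SGraph {
  vertex :> finType;
  adj : rel vertex;
  adj_sym : symmetric adj;
  adj_irrefl : irreflexive adj
}.

Definition edges (G : sgraph) : {set {set G}} :=
  [set e : {set G} | [exists x : G, exists y : G, adj x y && (e == [set x; y])]].

Definition gsize (G : sgraph) : nat := #|edges G|.

(* [ordS] is the cyclic successor of 'I_n. The first conjunct only matters for
   n = 1; this is the usual n-cycle, with n edges, for n >= 3. *)
Definition cycle_adj (n : nat) : rel 'I_n :=
  fun i j => (i != j) && ((j == ordS i) || (i == ordS j)).

Lemma cycle_adj_sym (n : nat) : symmetric (@cycle_adj n).
Proof. by move=> i j; rewrite /cycle_adj eq_sym orbC. Qed.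

Lemma cycle_adj_irrefl (n : nat) : irreflexive (@cycle_adj n).
Proof. by move=> i; rewrite /cycle_adj eqxx. Qed.

Definition cycle_graph (n : nat) : sgraph :=
  SGraph (@cycle_adj_sym n) (@cycle_adj_irrefl n).

Definition graceful_labeling (d : nat) (G : sgraph) (f : G -> nat) : Prop :=
  let m := gsize G %/ d in
  [/\ 0 < d, d %| gsize G,
      injective f,
      forall x : G, f x <= d * m.+1 - 1 &
      forall v : nat,
        (exists x y : G, adj x y /\ v = `|f x - f y|) <->
        (1 <= v <= d * m.+1 - 1 /\
         ~ exists j : nat, 1 <= j <= d - 1 /\ v = j * m.+1)].

Definition bipartition (G : sgraph) (X Y : {set G}) : Prop :=
  [/\ X :|: Y = [set: G], [disjoint X & Y] &
      forall x y : G, adj x y ->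
        (x \in X /\ y \in Y) \/ (x \in Y /\ y \in X)].

(* Existential quantification over the ordered pair (X, Y) accounts for the
   choice of the ordering of the two parts. *)
Definition graceful_alpha_labeling (d : nat) (G : sgraph) (f : G -> nat) : Prop :=
  graceful_labeling d f /\
  exists X Y : {set G}, bipartition X Y /\
    forall x y : G, x \in X -> y \in Y -> f x < f y.

(* Main.v *)
(** Walk around the cycle alternating small labels 0, 1, 2, ... on the even
    vertices with large labels 4k+1, 4k, 4k-1, ... on the odd ones: consecutive
    differences are 4k+1, 4k, 4k-1, ...  From vertex 2k on, raise the small
    labels by 2.  The differences then jump from 2k+3 to 2k, avoiding the
    forbidden value 2k+1, and the skipped value 2k+2 is exactly the label of
    the last vertex, hence the difference along the closing edge. *)

Require Import Defs.
From mathcomp Require Import all_boot all_order all_algebra.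
From mathcomp Require Import zify.

Lemma val_ordS_cases (n : nat) (i : 'I_n) :
  (i.+1 < n /\ ordS i = i.+1 :> nat) \/ (i.+1 = n /\ ordS i = 0 :> nat).
Proof.
have := ltn_ord i; rewrite leq_eqVlt => /orP[/eqP e|lt_in].
  by right; rewrite /= e modnn.
by left; rewrite /= modn_small.
Qed.

Lemma neq_ordS (n : nat) (i : 'I_n) : 1 < n -> i != ordS i.
Proof.
by move=> n_gt1; apply/eqP => /(congr1 val) /=; case: (val_ordS_cases _ i) => /= -[]; lia.
Qed.

Lemma edges_cycle_graph (n : nat) : 1 < n ->
  edges (cycle_graph n) = [set [set i; ordS i] | i : 'I_n].
Proof.
move=> n_gt1; apply/setP => e; rewrite inE; apply/existsP/imsetP.
  move=> [x /existsP[y /andP[/andP[_ /orP[/eqP-> | /eqP->]] /eqP->]]].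
    by exists x.
  by exists y; rewrite // setUC.
move=> [i _ ->]; exists i; apply/existsP; exists (ordS i).
by rewrite /= /cycle_adj neq_ordS //= !eqxx.
Qed.

(** The map from [i] to the edge [{i, ordS i}] is injective: a collision would make [i] and [j]
    successors of each other, forcing [n = 2]. *)
Lemma gsize_cycle_graph (n : nat) : 2 < n -> gsize (cycle_graph n) = n.
Proof.
move=> n_gt2; rewrite /gsize edges_cycle_graph ?(ltnW n_gt2) //.
rewrite card_imset ?card_ord // => i j eq_ij.
have: i \in [set j; ordS j] by rewrite -eq_ij set21.
have: j \in [set i; ordS i] by rewrite eq_ij set21.
rewrite !in_set2 => /orP[/eqP //|/eqP/(congr1 val) ji] /orP[/eqP //|/eqP/(congr1 val) ij].
move: ji ij (val_ordS_cases _ i) (val_ordS_cases _ j) => /=; lia.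
Qed.

Definition cycle_label (k j : nat) : nat :=
  if odd j then 4 * k + 1 - j./2 else j./2 + (if j < 2 * k then 0 else 2).

(** Parity-free closed form of the difference between positions [j] and [j + 1]. The test is on
    [j.+1] because the drop by 2 starts when the far endpoint reaches [2 * k], an even position. *)
Definition cycle_edge_label (k j : nat) : nat :=
  if j.+1 == 4 * k then 2 * k + 2
  else if j.+1 < 2 * k then 4 * k + 1 - j else 4 * k - 1 - j.

(** The gap between the two parities gives the alpha condition and reduces injectivity to positions
    of equal parity. *)
Lemma cycle_label_bounds (k j : nat) : j < 4 * k ->
  if odd j then 2 * k + 1 < cycle_label k j <= 4 * k + 1
  else cycle_label k j <= 2 * k + 1.
Proof. by rewrite /cycle_label; do ?case: ifP => ?; lia. Qed.

Lemma cycle_label_inj (k i j : nat) : i < 4 * k -> j < 4 * k ->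
  cycle_label k i = cycle_label k j -> i = j.
Proof.
move=> lti ltj; have := cycle_label_bounds _ _ lti; have := cycle_label_bounds _ _ ltj.
by rewrite /cycle_label; do 2 case: ifP => ?; do ?case: ifP => ?; lia.
Qed.

Lemma dist_cycle_label (k : nat) (i : 'I_(4 * k)) :
  `|cycle_label k i - cycle_label k (ordS i)| = cycle_edge_label k i.
Proof.
have := ltn_ord i; rewrite /cycle_label /cycle_edge_label.
by case: (val_ordS_cases _ i) => -[+ ->];
  do ?case: ifP => ?; lia.
Qed.

Lemma cycle_edge_label_range (k v : nat) : 0 < k ->
  (exists2 j, j < 4 * k & v = cycle_edge_label k j) <->
  1 <= v <= 4 * k + 1 /\ v <> 2 * k + 1.
Proof.
move=> k_gt0; rewrite /cycle_edge_label; split.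
  by move=> [j ltj ->]; do ?case: ifP => ?; lia.
(* The closing edge gives [2 * k + 2]; the other two branches are decreasing in [j] and are inverted
   on [1..2k] and [2k+3..4k+1]. *)
move=> v_range; have [->|v_neq] := eqVneq v (2 * k + 2).
  by exists (4 * k).-1; [lia | case: ifP; lia].
have [v_le|v_gt] := leqP v (2 * k).
  by exists (4 * k - 1 - v); [lia | do ?case: ifP => ?; lia].
by exists (4 * k + 1 - v); [lia | do ?case: ifP => ?; lia].
Qed.

(** Evenness of [n] matters at the wrap-around from [n - 1] to 0. *)
Lemma odd_ordS (n : nat) (i : 'I_n) : ~~ odd n -> odd (ordS i) = ~~ odd i.
Proof. by move=> n_even; case: (val_ordS_cases _ i) => -[+ ->]; lia. Qed.

Lemma bipartition_even_cycle (n : nat) : ~~ odd n ->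
  @bipartition (cycle_graph n) [set i : 'I_n | ~~ odd i] [set i : 'I_n | odd i].
Proof.
move=> n_even; split.
- by apply/setP => i; rewrite !inE orNb.
- by rewrite -setI_eq0; apply/eqP/setP => i; rewrite !inE andNb.
move=> x y /andP[_ adj_xy]; rewrite !inE.
by case/orP: adj_xy => /eqP->; rewrite odd_ordS //; case: (odd _); auto.
Qed.

Theorem theorem4p1 (k : nat) (hk : 1 <= k) :
  exists f : cycle_graph (4 * k) -> nat, graceful_alpha_labeling 2 f.
Proof.
exists (fun i : 'I_(4 * k) => cycle_label k i); split; last first.
  exists [set i : 'I_(4 * k) | ~~ odd i], [set i : 'I_(4 * k) | odd i].
  split; first by apply: bipartition_even_cycle; lia.
  move=> x y; rewrite !inE => x_even y_odd.
  have := cycle_label_bounds _ _ (ltn_ord x); have := cycle_label_bounds _ _ (ltn_ord y).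
  by rewrite y_odd (negbTE x_even); lia.
rewrite /graceful_labeling gsize_cycle_graph; last by lia.
have -> : (4 * k) %/ 2 = 2 * k by lia.
split=> //; first by lia.
- by move=> i j /cycle_label_inj eq_ij; apply/val_inj/eq_ij.
- by move=> i; have := cycle_label_bounds _ _ (ltn_ord i); case: ifP; lia.
move=> v; have [labelP rangeP] := cycle_edge_label_range k v hk; split.
  move=> [x [y [/andP[_ adj_xy] v_def]]].
  (* With [d = 2] only [j = 1] is allowed, so the sole forbidden multiple is [2 * k + 1]. *)
  have [|v_range v_neq] := labelP; last by split; [lia | case=> -[|[|j]] []; lia].
  case/orP: adj_xy v_def => /eqP->.
    by rewrite dist_cycle_label; exists x.
  by rewrite distnC dist_cycle_label; exists y.
move=> [v_range v_neq]; have [|j ltj ->] := rangeP.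
  by split; [lia | move=> v_def; apply: v_neq; exists 1; lia].
pose i := Ordinal ltj; exists i, (ordS i); rewrite dist_cycle_label.
by rewrite /= /cycle_adj neq_ordS ?eqxx //; lia.
Qed.
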